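(* Let $(\mathfrak g,[\cdot,\cdot]_{\mathfrak g})$ and $(\mathfrak h,[\cdot,\cdot]_{\mathfrak h})$ be Leibniz algebras, $(\mathfrak h,\rho^L,\rho^R)$ a Leibniz $\mathfrak g$-representation, and $H:\mathfrak g\to\mathfrak h$ a crossed homomorphism. Let $H_t=H+tH_1$ be a linear deformation of $H$. Then the linear term $H_1$ is a $1$-cocycle in the cohomology of $H$. Its cohomology class in $\mathcal H^1_H(\mathfrak g,\mathfrak h)$ depends only on the equivalence class of $H_t$; that is, if $H'_t=H+tH'_1$ is a linear deformation of $H$ equivalent to $H_t$, then $H_1$ and $H'_1$ define the same class in $\mathcal H^1_H(\mathfrak g,\mathfrak h)$.
   Context: All vector spaces are over a field $\mathbf k$ of characteristic $0$. A Leibniz algebra is a vector space $\mathfrak g$ with a bilinear bracket satisfying $[x,[y,z]_{\mathfrak g}]_{\mathfrak g}=[[x,y]_{\mathfrak g},z]_{\mathfrak g}+[y,[x,z]_{\mathfrak g}]_{\mathfrak g}$ for all $x,y,z$; write $L_x=[x,\cdot]_{\mathfrak g}$. A representation of $\mathfrak g$ is a vector space $V$ with linear maps $\rho^L,\rho^R:\mathfrak g\to \mathrm{End}(V)$ such that for all $x,y\in\mathfrak g$: $\rho^L([x,y]_{\mathfrak g})=\rho^L(x)\rho^L(y)-\rho^L(y)\rho^L(x)$; $\rho^R([x,y]_{\mathfrak g})=\rho^L(x)\rho^R(y)-\rho^R(y)\rho^L(x)$; $\rho^R([x,y]_{\mathfrak g})=\rho^L(x)\rho^R(y)+\rho^R(y)\rho^R(x)$.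 A Leibniz $\mathfrak g$-representation is a Leibniz algebra $\mathfrak h$ with linear maps $\rho^L,\rho^R:\mathfrak g\to\mathrm{End}(\mathfrak h)$ making $(\mathfrak h,\rho^L,\rho^R)$ a representation of $\mathfrak g$ and such that for all $h,k\in\mathfrak h$, $x\in\mathfrak g$: $\rho^L(x)[h,k]_{\mathfrak h}=[\rho^L(x)h,k]_{\mathfrak h}+[h,\rho^L(x)k]_{\mathfrak h}$; $[h,\rho^R(x)k]_{\mathfrak h}=\rho^R(x)[h,k]_{\mathfrak h}+[k,\rho^R(x)h]_{\mathfrak h}$; $[h,\rho^L(x)k]_{\mathfrak h}=[\rho^R(x)h,k]_{\mathfrak h}+\rho^L(x)[h,k]_{\mathfrak h}$. A crossed homomorphism is a linear map $H:\mathfrak g\to\mathfrak h$ with $H([x,y]_{\mathfrak g})=\rho^L(x)H(y)+\rho^R(y)H(x)+[H(x),H(y)]_{\mathfrak h}$ for all $x,y\in\mathfrak g$. A morphism from a crossed homomorphism $H$ to a crossed homomorphism $H'$ (both $\mathfrak g\to\mathfrak h$) is a pair of Leibniz algebra morphisms $\phi_{\mathfrak g}:\mathfrak g\to\mathfrak g$, $\phi_{\mathfrak h}:\mathfrak h\to\mathfrak h$ with $\phi_{\mathfrak h}\circ H=H'\circ\phi_{\mathfrak g}$, $\phi_{\mathfrak h}(\rho^L(x)h)=\rho^L(\phi_{\mathfrak g}(x))\phi_{\mathfrak h}(h)$ and $\phi_{\mathfrak h}(\rho^R(x)h)=\rho^R(\phi_{\mathfrak g}(x))\phi_{\mathfrak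 h}(h)$ for all $x\in\mathfrak g$, $h\in\mathfrak h$. Cohomology of $H$: put $\rho^L_H(x)h=\rho^L(x)h+[H(x),h]_{\mathfrak h}$, $\rho^R_H(x)h=\rho^R(x)h+[h,H(x)]_{\mathfrak h}$, and $C^n(\mathfrak g,\mathfrak h)=\mathrm{Hom}(\mathfrak g^{\otimes n},\mathfrak h)$ for $n\ge0$. The cohomology $\mathcal H^*_H(\mathfrak g,\mathfrak h)$ of $H$ is that of the complex $(C^*(\mathfrak g,\mathfrak h),d_H)$ with $d_H f=(-1)^{n-1}\delta_{\mathrm{Leib}}f$ for $f\in C^n(\mathfrak g,\mathfrak h)$, where $$(\delta_{\mathrm{Leib}}f)(x_1,\dots,x_{n+1})=\sum_{i=1}^n(-1)^{i+1}\rho^L_H(x_i)f(x_1,\dots,\hat x_i,\dots,x_{n+1})+(-1)^{n+1}\rho^R_H(x_{n+1})f(x_1,\dots,x_n)$$ $$+\sum_{1\le i<j\le n+1}(-1)^if(x_1,\dots,\hat x_i,\dots,x_{j-1},[x_i,x_j]_{\mathfrak g},x_{j+1},\dots,x_{n+1}).$$ A linear deformation of $H$ is a sum $H_t=H+tH_1$, with $H_1:\mathfrak g\to\mathfrak h$ linear, such that $H_t$ is a crossed homomorphism for all values of $t$. Two linear deformations $H_t=H+tH_1$ and $H'_t=H+tH'_1$ are equivalent if there exists $x\in\mathfrak g$ such that $\phi_t=\mathrm{id}_{\mathfrak g}+tL_x$, $\psi_t=\mathrm{id}_{\mathfrak h}+t\rho^L(x)$ form a morphism $(\phi_t,\psi_t)$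 from $H_t$ to $H'_t$ (for all $t$). *)

(* Defs.v *)
From HB Require Import structures.
From mathcomp Require Import all_boot all_order all_algebra sesquilinear.
From mathcomp Require Import generic_quotient ring_quotient.
From mathcomp Require Import boolp classical_sets functions.

Set Implicit Arguments.
Unset Strict Implicit.
Unset Printing Implicit Defensive.

Import GRing.Theory.
Local Open Scope ring_scope.
Local Open Scope quotient_scope.

(* Vector spaces are left modules over a field, of arbitrary dimension. *)
HB.mixin Record Lmodule_isLeibniz (K : fieldType) g of GRing.Lmodule K g := {
  lbr : {bilinear g -> g -> g};
  lbr_leibniz : forall x y z : g,
    lbr x (lbr y z) = lbr (lbr x y) z + lbr y (lbr x z)
}.

#[short(type="leibnizAlgType")]
HB.structure Definition LeibnizAlgebra (K : fieldType) :=
  {g of Lmodule_isLeibniz K g & GRing.Lmodule K g}.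

Section Representations.
Variables (K : fieldType) (g : leibnizAlgType K).

(* A linear map g -> End(V) is a bilinear map g -> V -> V. *)
Record representation (V : lmodType K) (rhoL rhoR : {bilinear g -> V -> V}) :
    Prop := {
  rhoL_lbr : forall x y v,
    rhoL (lbr x y) v = rhoL x (rhoL y v) - rhoL y (rhoL x v);
  rhoR_lbr : forall x y v,
    rhoR (lbr x y) v = rhoL x (rhoR y v) - rhoR y (rhoL x v);
  rhoR_lbrD : forall x y v,
    rhoR (lbr x y) v = rhoL x (rhoR y v) + rhoR y (rhoR x v)
}.

Record leibniz_representation (h : leibnizAlgType K)
    (rhoL rhoR : {bilinear g -> h -> h}) : Prop := {
  leibniz_rep : representation rhoL rhoR;
  leibniz_repLL : forall x (u v : h),
    rhoL x (lbr u v) = lbr (rhoL x u) v + lbr u (rhoL x v);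
  leibniz_repRR : forall x (u v : h),
    lbr u (rhoR x v) = rhoR x (lbr u v) + lbr v (rhoR x u);
  leibniz_repLR : forall x (u v : h),
    lbr u (rhoL x v) = lbr (rhoR x u) v + rhoL x (lbr u v)
}.

End Representations.

Definition leibniz_morphism (K : fieldType) (g g' : leibnizAlgType K)
    (f : {linear g -> g'}) : Prop :=
  forall x y, f (lbr x y) = lbr (f x) (f y).

Section CrossedHomomorphisms.
Variables (K : fieldType) (g h : leibnizAlgType K).
Variables (rhoL rhoR : {bilinear g -> h -> h}).
Implicit Types H : {linear g -> h}.

Definition crossed_hom H : Prop :=
  forall x y, H (lbr x y) = rhoL x (H y) + rhoR y (H x) + lbr (H x) (H y).

Record crossed_hom_morphism H H' (phi : {linear g -> g})
    (psi : {linear h -> h}) : Prop := {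
  chm_phi : leibniz_morphism phi;
  chm_psi : leibniz_morphism psi;
  chm_comm : forall x, psi (H x) = H' (phi x);
  chm_rhoL : forall x v, psi (rhoL x v) = rhoL (phi x) (psi v);
  chm_rhoR : forall x v, psi (rhoR x v) = rhoR (phi x) (psi v)
}.

Definition deform H H1 (t : K) : {linear g -> h} := H \+ t \*: H1.

Definition linear_deformation H H1 : Prop :=
  forall t : K, crossed_hom (deform H H1 t).

Definition equivalent_deformations H H1 H1' : Prop :=
  exists x : g, forall t : K,
    crossed_hom_morphism (deform H H1 t) (deform H H1' t)
      (idfun \+ t \*: lbr x) (idfun \+ t \*: rhoL x).

End CrossedHomomorphisms.

(* Hom(g^{(x) n}, V), as n-multilinear maps on tuples indexed by 'I_n.        *)
(* For n = 0 the condition is void and there is exactly one tuple, so that    *)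
(* cochains are the elements of V.                                            *)
Section Cochains.
Variables (K : fieldType) (g V : lmodType K).

Definition upd n (x : {ffun 'I_n -> g}) (i : 'I_n) (u : g) : {ffun 'I_n -> g} :=
  [ffun j => if j == i then u else x j].

Definition multilinear n (f : {ffun 'I_n -> g} -> V) : Prop :=
  forall i x, linear (fun u => f (upd x i u)).

Definition multilinear_pred n : {pred {ffun 'I_n -> g} -> V} :=
  fun f => `[< multilinear f >].

Lemma multilinear_submod_closed n : submod_closed (@multilinear_pred n).
Proof.
split=> [|a f1 f2 /asboolP lf1 /asboolP lf2]; apply/asboolP => i x b u v.
  by rewrite scaler0 addr0.
rewrite /= !fctE lf1 lf2 !scalerDr !scalerA [b * a]mulrC -!addrA.
by congr (_ + _); rewrite addrCA.
Qed.

HB.instance Definition _ n := GRing.isSubmodClosed.Build K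
  ({ffun 'I_n -> g} -> V) (@multilinear_pred n) (@multilinear_submod_closed n).

Record cochain n := Cochain {
  cochain_fun :> {ffun 'I_n -> g} -> V;
  _ : cochain_fun \in @multilinear_pred n
}.

HB.instance Definition _ n := [isSub for @cochain_fun n].
HB.instance Definition _ n := [Choice of cochain n by <:].
HB.instance Definition _ n := [SubChoice_isSubLmodule of cochain n by <:].

Lemma cochainP n (f : cochain n) : multilinear f.
Proof. by apply/asboolP; case: f. Qed.

Lemma cochain1_subproof (f : {linear g -> V}) :
  (fun x : {ffun 'I_1 -> g} => f (x ord0)) \in @multilinear_pred 1.
Proof.
by apply/asboolP => i x a u v; rewrite !ffunE (ord1 i) eqxx linearP.
Qed.

Definition cochain1 (f : {linear g -> V}) : cochain 1 :=
  Cochain (cochain1_subproof f).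

End Cochains.

Section Cohomology.
Variables (K : fieldType) (g h : leibnizAlgType K).
Variables (rhoL rhoR : {bilinear g -> h -> h}) (H : {linear g -> h}).

Definition rhoLH (x : g) (v : h) : h := rhoL x v + lbr (H x) v.
Definition rhoRH (x : g) (v : h) : h := rhoR x v + lbr v (H x).

Definition omit n (i : 'I_n.+1) (x : {ffun 'I_n.+1 -> g}) : {ffun 'I_n -> g} :=
  [ffun k => x (lift i k)].

(* Entry i is removed and entry j is replaced by [x_i, x_j]. *)
Definition contract n (i j : 'I_n.+1) (x : {ffun 'I_n.+1 -> g}) :
    {ffun 'I_n -> g} :=
  [ffun k => if lift i k == j then lbr (x i) (x j) else x (lift i k)].

(* Indices start at 0 here, which shifts the usual exponents by one. *)
Definition delta_fun n (f : {ffun 'I_n -> g} -> h)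
    (x : {ffun 'I_n.+1 -> g}) : h :=
  \sum_(i < n.+1 | (i < n)%N) (-1) ^+ i *: rhoLH (x i) (f (omit i x))
  + (-1) ^+ n.+1 *: rhoRH (x ord_max) (f (omit ord_max x))
  + \sum_(i < n.+1) \sum_(j < n.+1 | (i < j)%N)
      (-1) ^+ i.+1 *: f (contract i j x).

Lemma rhoLH_linear x : linear (rhoLH x).
Proof.
move=> a u v; rewrite /rhoLH !linearP scalerDr -!addrA.
by congr (_ + _); rewrite addrCA.
Qed.

Lemma rhoRH_linear x : linear (rhoRH x).
Proof.
move=> a u v; rewrite /rhoRH linearP linearPl scalerDr -!addrA.
by congr (_ + _); rewrite addrCA.
Qed.

Lemma rhoLH_linearl v : linear (rhoLH^~ v).
Proof.
move=> a x y; rewrite /rhoLH linearPl linearP linearPl scalerDr -!addrA.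
by congr (_ + _); rewrite addrCA.
Qed.

Lemma rhoRH_linearl v : linear (rhoRH^~ v).
Proof.
move=> a x y; rewrite /rhoRH linearPl !linearP scalerDr -!addrA.
by congr (_ + _); rewrite addrCA.
Qed.

Lemma linear_signed (s : K) (F : g -> h) : linear F -> linear (fun u => s *: F u).
Proof. by move=> lF a u v; rewrite lF scalerDr !scalerA mulrC. Qed.

Lemma linear_addf (F G : g -> h) :
  linear F -> linear G -> linear (fun u => F u + G u).
Proof.
move=> lF lG a u v; rewrite lF lG scalerDr -!addrA.
by congr (_ + _); rewrite addrCA.
Qed.

Lemma linear_sumf (I : Type) (r : seq I) (P : pred I) (F : I -> g -> h) :
  (forall i, P i -> linear (F i)) -> linear (fun u => \sum_(i <- r | P i) F i u).
Proof.
move=> lF a u v; rewrite scaler_sumr -big_split /=.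
by apply: eq_bigr => i Pi; rewrite lF.
Qed.

Lemma omit_upd_eq n (i : 'I_n.+1) x u : omit i (upd x i u) = omit i x.
Proof. by apply/ffunP => k; rewrite !ffunE eq_sym (negPf (neq_lift i k)). Qed.

Lemma omit_upd_neq n (i : 'I_n.+1) k x u :
  omit i (upd x (lift i k) u) = upd (omit i x) k u.
Proof. by apply/ffunP => l; rewrite !ffunE (inj_eq lift_inj). Qed.

Lemma contractE n (i : 'I_n.+1) l x :
  contract i (lift i l) x = upd (omit i x) l (lbr (x i) (x (lift i l))).
Proof. by apply/ffunP => k; rewrite !ffunE (inj_eq lift_inj). Qed.

Lemma upd_upd n (x : {ffun 'I_n -> g}) i u v : upd (upd x i u) i v = upd x i v.
Proof. by apply/ffunP => k; rewrite !ffunE; case: (k == i). Qed.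

Lemma updC n (x : {ffun 'I_n -> g}) i j u v : i != j ->
  upd (upd x i u) j v = upd (upd x j v) i u.
Proof.
move=> ij; apply/ffunP => k; rewrite !ffunE.
by have [->|] := eqVneq k i; rewrite ?(negPf ij).
Qed.

Lemma delta_multilinear n (f : cochain g h n) :
  delta_fun f \in @multilinear_pred K g h n.+1.
Proof.
have lf := cochainP f.
have term (R : g -> h -> h) (i k : 'I_n.+1) x :
    (forall u, linear (R u)) -> (forall v, linear (R^~ v)) ->
    linear (fun u => R (upd x k u i) (f (omit i (upd x k u)))).
  move=> lr ll a u v; have [l ->|->] := unliftP i k.
    by rewrite !omit_upd_neq lf !ffunE (negPf (neq_lift i l)) lr.
  by rewrite !omit_upd_eq !ffunE eqxx ll.
apply/asboolP => k x; apply: linear_addf; first apply: linear_addf.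
- apply: linear_sumf => i _; apply: linear_signed.
  by apply: term; [apply: rhoLH_linear | apply: rhoLH_linearl].
- apply: linear_signed.
  by apply: term; [apply: rhoRH_linear | apply: rhoRH_linearl].
apply: linear_sumf => i _; apply: linear_sumf => j ij.
apply: linear_signed => a u v.
have /unlift_some[l ->{j ij} _] : i != j by rewrite neq_ltn ij.
rewrite !contractE; have [m ->|->] := unliftP i k.
  rewrite !omit_upd_neq !ffunE (negPf (neq_lift i m)) !(inj_eq lift_inj).
  have [->|lm] := eqVneq l m; first by rewrite !upd_upd linearP lf.
  by rewrite ![upd (upd _ m _) _ _]updC ?lf // eq_sym.
rewrite !omit_upd_eq !ffunE eqxx eq_sym (negPf (neq_lift i l)).
by rewrite linearPl lf.
Qed.

Definition delta n (f : cochain g h n) : cochain g h n.+1 :=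
  Cochain (delta_multilinear f).

(* d_H f = (-1)^(n-1) delta f; the exponent n+1 has the same parity and is    *)
(* also meaningful for n = 0.                                                 *)
Definition dH n (f : cochain g h n) : cochain g h n.+1 :=
  (-1) ^+ n.+1 *: delta f.

Lemma delta_fun_linear n a (f f1 f2 : {ffun 'I_n -> g} -> h) x :
  (forall y, f y = a *: f1 y + f2 y) ->
  delta_fun f x = a *: delta_fun f1 x + delta_fun f2 x.
Proof.
move=> fE.
have sgn (s : K) (F : h -> h) (u v : h) : linear F ->
  s *: F (a *: u + v) = a *: (s *: F u) + s *: F v.
  by move=> lF; rewrite lF scalerDr !scalerA mulrC.
rewrite /delta_fun [a *: (_ + _)]scalerDr [RHS]addrACA; congr (_ + _).
  rewrite [a *: (_ + _)]scalerDr [RHS]addrACA; congr (_ + _).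
    rewrite scaler_sumr -big_split /=; apply: eq_bigr => i _.
    by rewrite fE (sgn _ (rhoLH (x i))) //; apply: rhoLH_linear.
  by rewrite fE (sgn _ (rhoRH (x ord_max))) //; apply: rhoRH_linear.
rewrite scaler_sumr -big_split /=; apply: eq_bigr => i _.
rewrite scaler_sumr -big_split /=; apply: eq_bigr => j _.
by rewrite fE (sgn _ idfun).
Qed.

Lemma delta_linear n : linear (@delta n).
Proof.
by move=> a f1 f2; apply/val_inj/funext => x; apply: delta_fun_linear.
Qed.

Lemma dH_linear n : linear (@dH n).
Proof.
by move=> a f1 f2; rewrite /dH delta_linear scalerDr !scalerA mulrC.
Qed.

HB.instance Definition _ n :=
  GRing.isLinear.Build K (cochain g h n) (cochain g h n.+1) *:%R (@dH n)
    (@dH_linear n).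

Definition cocycle n : {pred cochain g h n} := fun f => dH f == 0.

Lemma cocycle_submod_closed n : submod_closed (@cocycle n).
Proof.
split=> [|a f1 f2 /eqP d1 /eqP d2]; apply/eqP; first exact: linear0.
by rewrite linearP /= d1 d2 scaler0 addr0.
Qed.

HB.instance Definition _ n := GRing.isSubmodClosed.Build K
  (cochain g h n) (@cocycle n) (@cocycle_submod_closed n).

Record cocycles n := Cocycle {
  cocycle_val :> cochain g h n;
  _ : cocycle_val \in @cocycle n
}.

HB.instance Definition _ n := [isSub for @cocycle_val n].
HB.instance Definition _ n := [Choice of cocycles n by <:].
HB.instance Definition _ n := [SubChoice_isSubLmodule of cocycles n by <:].

Definition is_coboundary n : cochain g h n -> Prop :=
  match n with
  | 0 => fun f => f = 0
  | m.+1 => fun f => exists b : cochain g h m, f = dH b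
  end.

Definition coboundary n : {pred cocycles n} :=
  fun f => `[< is_coboundary (val f) >].

Lemma coboundary_submod_closed n : submod_closed (@coboundary n).
Proof.
split=> [|a f1 f2 /asboolP b1 /asboolP b2]; apply/asboolP.
  by case: n => [|n] //=; exists 0; rewrite linear0.
case: n => [|n] in f1 f2 b1 b2 *; rewrite /= in b1 b2 *.
  by rewrite b1 b2 scaler0 addr0.
by case: b1 b2 => c1 b1 [c2 b2]; exists (a *: c1 + c2); rewrite linearP b1 b2.
Qed.

HB.instance Definition _ n := GRing.isSubmodClosed.Build K
  (cocycles n) (@coboundary n) (@coboundary_submod_closed n).

(* Coboundaries are taken among the cocycles, so the quotient is ker / im      *)
(* whether or not dH \o dH = 0 is known.                                      *)
Definition cohomology n : zmodType := @Quotient.quot _ (@coboundary n).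

Definition cohomology_class n (f : cochain g h n) (Zf : f \in @cocycle n) :
    cohomology n :=
  \pi_(cohomology n) (Cocycle Zf).

End Cohomology.

Arguments cocycle {K g h} rhoL rhoR H n.

(* Main.v *)
(* Substituting t = 1 and t = -1 in the equations that hold for all t and       *)
(* subtracting isolates the coefficient of t, as 2 is invertible.  In the       *)
(* crossed homomorphism equation for H + t H_1 this coefficient is the cocycle  *)
(* condition on H_1.  In the equation psi_t H_t = H'_t phi_t it gives           *)
(*   H_1 u - H'_1 u = H [x, u] - rho^L(x) (H u) = rho^R_H(u) (H x),             *)
(* where the last step holds because H is crossed: the difference is the        *)
(* coboundary of the 0-cochain H x.                                             *)
Require Import Defs.
From mathcomp Require Import all_boot all_order all_algebra sesquilinear.
From mathcomp Require Import generic_quotient ring_quotient.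
From mathcomp Require Import boolp functions.

Set Implicit Arguments.
Unset Strict Implicit.
Unset Printing Implicit Defensive.

Import GRing.Theory.
Local Open Scope ring_scope.

(** Both hypotheses are identities of degree at most two in [t], and [linear_coef_inj] extracts
    their linear coefficients. The crossed equation for [H + t H1] yields the cocycle identity,
    which [delta_fun1] matches with the differential in degree 1. The intertwining equation yields
    [H1 - H1'] as the map that [dH0E] recognises as the coboundary of [H x]. *)

Lemma linear_coef_inj (K : fieldType) (V : lmodType K) (a b c d : V) :
  2%:R != 0 :> K ->
  (forall t : K, t *: a + (t * t) *: c = t *: b + (t * t) *: d) -> a = b.
Proof.
move=> K2 E; have {}E t : t *: (a - b) = (t * t) *: (d - c).
  rewrite !scalerBr; apply/eqP; rewrite subr_eq addrAC eq_sym subr_eq addrC.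
  by rewrite E addrC.
have := E (-1); rewrite mulrNN -E scaleN1r scale1r => /eqP.
rewrite eq_sym -addr_eq0 -mulr2n -scaler_nat scaler_eq0 (negPf K2) subr_eq0.
by move/eqP.
Qed.

Lemma const_cochain0_subproof (K : fieldType) (g V : lmodType K) (v : V) :
  (fun _ : {ffun 'I_0 -> g} => v) \in @multilinear_pred K g V 0.
Proof. by apply/asboolP => -[]. Qed.

Section CrossedHomomorphismDeformations.
Variables (K : fieldType) (g h : leibnizAlgType K).
Variables (rhoL rhoR : {bilinear g -> h -> h}).
Implicit Types H : {linear g -> h}.

Lemma linear_deformation_cocycle H H1 : 2%:R != 0 :> K ->
  crossed_hom rhoL rhoR H -> linear_deformation rhoL rhoR H H1 ->
  forall x y, H1 (lbr x y) =
    rhoLH rhoL H x (H1 y) + rhoRH rhoR H y (H1 x).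
Proof.
move=> K2 cH dH1 x y; apply: (linear_coef_inj (c := 0) (d := lbr (H1 x) (H1 y)) K2) => t.
(* Restoring the constant term turns the goal into the crossed equation of the deformation at
   [t]. *)
apply: (addrI (H (lbr x y))); rewrite scaler0 addr0.
have /= -> := dH1 t x y; rewrite cH (linearDl _ _ (H x)) !linearD !linearZ /=.
rewrite !linearZl_LR /= (AC (2*2*(2*2)) ((1*3*5)*((2*6*(4*7))*8))) /=.
by rewrite scalerA.
Qed.

Lemma equivalent_deformations_rhoRH H H1 H1' (x : g) : 2%:R != 0 :> K ->
  crossed_hom rhoL rhoR H ->
  (forall t u, (idfun \+ t \*: rhoL x) (deform H H1 t u) =
               deform H H1' t ((idfun \+ t \*: lbr x) u)) ->
  forall u, H1 u = H1' u + rhoRH rhoR H u (H x).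
Proof.
move=> K2 cH E u.
apply: (linear_coef_inj (c := rhoL x (H1 u)) (d := H1' (lbr x u)) K2) => t.
(* [H u] is the constant term; [t *: rhoL x (H u)] comes from psi_t on the left and from expanding
   [H (lbr x u)] on the right, so it cancels. *)
apply: (addrI (H u + t *: rhoL x (H u))); rewrite -!scalerA addrACA.
have /= := E t u; rewrite !linearD !linearZ /= => ->; rewrite cH !scalerDr.
by rewrite (AC (1*3*2) ((1*2)*((5*(3*4))*6))).
Qed.

Lemma delta_fun1 H (f : {linear g -> h}) (x : {ffun 'I_2 -> g}) :
  delta_fun rhoL rhoR H (cochain1 f) x =
    rhoLH rhoL H (x ord0) (f (x ord_max)) +
    rhoRH rhoR H (x ord_max) (f (x ord0)) - f (lbr (x ord0) (x ord_max)).
Proof.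
rewrite /delta_fun /= big_mkcond !big_ord_recl !big_ord0 /=.
rewrite !(big_mkcond (fun j : 'I_2 => _ < j)%N) !big_ord_recl !big_ord0 /=.
rewrite !addr0 !add0r !ffunE /= expr0 expr1 sqrrN expr1n !scale1r scaleN1r.
have -> : lift ord0 ord0 = ord_max :> 'I_2 by apply/val_inj.
by have -> : lift ord_max ord0 = ord0 :> 'I_2 by apply/val_inj.
Qed.

Lemma cocycle1P H (f : {linear g -> h}) :
  (forall x y, f (lbr x y) = rhoLH rhoL H x (f y) + rhoRH rhoR H y (f x)) ->
  cochain1 f \in cocycle rhoL rhoR H 1.
Proof.
move=> fE; suff d0 : delta rhoL rhoR H (cochain1 f) = 0.
  by apply/eqP; rewrite /dH d0 scaler0.
by apply/val_inj/funext => x; rewrite /= delta_fun1 fE subrr.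
Qed.

(** In degree 0 both sums are empty; the sign -1 of the remaining rho^R term cancels the sign -1 in
    [dH]. *)
Lemma dH0E H (v : h) x :
  dH rhoL rhoR H (Cochain (const_cochain0_subproof g v)) x
  = rhoRH rhoR H (x ord0) v.
Proof.
rewrite /dH /= fctE /delta_fun big_pred0 // big_ord1 big_pred0; last first.
  by move=> j; rewrite (ord1 j).
by rewrite expr1 add0r addr0 scalerA mulrNN mulr1 scale1r (ord1 ord_max).
Qed.

End CrossedHomomorphismDeformations.

Theorem theorem4p2 (K : fieldType) (charK : [pchar K] =i pred0)
    (g h : leibnizAlgType K) (rhoL rhoR : {bilinear g -> h -> h})
    (rho_rep : leibniz_representation rhoL rhoR)
    (H : {linear g -> h}) (H_crossed : crossed_hom rhoL rhoR H)
    (H1 : {linear g -> h}) (H1_def : linear_deformation rhoL rhoR H H1) :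
  exists Z1 : cochain1 H1 \in cocycle rhoL rhoR H 1,
    forall H1' : {linear g -> h},
      linear_deformation rhoL rhoR H H1' ->
      equivalent_deformations rhoL rhoR H H1 H1' ->
      exists Z1' : cochain1 H1' \in cocycle rhoL rhoR H 1,
        cohomology_class Z1 = cohomology_class Z1'.
Proof.
have K2 : 2%:R != 0 :> K by rewrite ((pcharf0P K).1 charK).
have Z F : linear_deformation rhoL rhoR H F ->
    cochain1 F \in cocycle rhoL rhoR H 1.
  by move=> dF; apply/cocycle1P/linear_deformation_cocycle.
exists (Z _ H1_def) => H1' H1'_def [x chm]; exists (Z _ H1'_def).
have H1E : forall u, H1 u = H1' u + rhoRH rhoR H u (H x).
  apply: (equivalent_deformations_rhoRH K2 H_crossed) => t u.
  by case: (chm t) => _ _ ->.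
(* Two classes agree when the difference of their cocycles is a coboundary. *)
apply/eqP; rewrite -Quotient.idealrBE; apply/asboolP.
exists (Cochain (const_cochain0_subproof g (H x))).
apply/val_inj/funext => u; apply: etrans (esym (dH0E _ _ _ _ _)) => /=.
by rewrite !fctE H1E addrAC subrr add0r.
Qed.
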